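(* Let $G$ be a finitely generated group and let $\mathcal{S}=\{s_1,\dots,s_n\}$ ($n>1$) be an ordered finite generating set of $G$ having Property $F$ which defines a Dehornoy-like ordering $<_D$. Let $\mathcal{A}=\{a_1,\dots,a_n\}$ be the twisted generating set of $\mathcal{S}$. If $a_na_{n-1}a_n\neq a_{n-1}$, then $<_D$ is an accumulation point of the set of its conjugates $\{<_D\cdot\, g\}_{g\in G}$ in $\mathrm{LO}(G)$. Thus $<_D$ is not isolated in $\mathrm{LO}(G)$, and the $\sigma(\mathcal{S})$-positive monoid $\Sigma_{\mathcal{S}}$ is not finitely generated.
   Context: A left ordering of $G$ is a total order $<$ with $g<g' \Rightarrow hg<hg'$; its positive cone is $P=\{g\in G : 1<g\}$. A subset $P\subset G$ is the positive cone of a left ordering iff $P\cdot P\subset P$ and $G=P\sqcup\{1\}\sqcup P^{-1}$. The set $\mathrm{LO}(G)$ of left orderings is topologized as a subspace of $2^{G-\{1\}}$ (product topology, $2$ discrete) by identifying an ordering with its positive cone. For a left ordering $<$ and $g\in G$, the conjugate ordering $<\cdot\,g\;=\;<_g$ is defined by $x<_g x' \iff xg<x'g$. Let $\mathcal{S}=\{s_1,\dots,s_n\}$ be an ordered finite generating set of $G$. A word on $\mathcal{S}\cup\mathcal{S}^{-1}$ is $i$-positive if it contains at least one $s_i$ and contains none of $s_1^{\pm1},\dots,s_{i-1}^{\pm1},s_i^{-1}$. An element is $\sigma(\mathcal{S})$-positive if it is represented by an $i$-positive word for some $1\le i\le n$; the set of such elements, closed under multiplication, is $\Sigma_{\mathcal{S}}$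 (called the $\sigma(\mathcal{S})$-positive monoid; finite generation means as a semigroup). $\mathcal{S}$ defines a Dehornoy-like ordering $<_D$ if $\Sigma_{\mathcal{S}}$ is the positive cone of a left ordering $<_D$ of $G$. The twisted generating set of $\mathcal{S}$ is the ordered generating set $\mathcal{A}=\{a_1,\dots,a_n\}$ with $a_i=(s_is_{i+1}\cdots s_n)^{(-1)^{n-i+1}}$. Let $P_{\mathcal{A}}^{(i)}$ be the set of elements represented by nonempty words in $a_i,\dots,a_n$ (no inverses). $\mathcal{S}$ has Property $F$ if for all $1\le i\le n-1$: $a_i\,(P_{\mathcal{A}}^{(i+1)})^{-1}a_i^{-1}\subset P_{\mathcal{A}}^{(i)}$ and $a_i^{-1}(P_{\mathcal{A}}^{(i+1)})^{-1}a_i\subset P_{\mathcal{A}}^{(i)}$. *)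

(* Defs.v *)
From HB Require Import structures.
From mathcomp Require Import all_boot all_order all_algebra all_fingroup.
From mathcomp Require Import all_classical all_reals all_analysis.

Set Implicit Arguments.
Unset Strict Implicit.
Unset Printing Implicit Defensive.

Local Open Scope classical_set_scope.
Local Open Scope group_scope.

(* Orders are strict and, classically, may be taken boolean-valued. *)
Record left_ordering (G : groupType) := LeftOrdering {
  lo_lt :> rel G;
  lo_irr : irreflexive lo_lt;
  lo_trans : transitive lo_lt;
  lo_total : forall x y, x != y -> lo_lt x y || lo_lt y x;
  lo_mull : forall h x y, lo_lt x y -> lo_lt (h * x) (h * y)
}.

HB.instance Definition _ (G : groupType) := gen_eqMixin (left_ordering G).
HB.instance Definition _ (G : groupType) := gen_choiceMixin (left_ordering G).

Definition positive_cone (G : groupType) (L : left_ordering G) : set G :=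
  [set g | L 1 g].

(* The positive cone of L as a point of 2^(G - {1}). *)
Definition cone_point (G : groupType) (L : left_ordering G) :
    {ptws {g : G | g != 1} -> bool} :=
  fun g => L 1 (val g).

Lemma cone_point_inj (G : groupType) : injective (@cone_point G).
Proof.
move=> L M /(congr1 (fun f => f _)) eqLM.
have eqLM1 g : g != 1 -> L 1 g = M 1 g.
  by move=> g1; exact: (eqLM (exist _ g g1)).
have ltE (K : left_ordering G) x y : K x y = K 1 (x^-1 * y).
  apply/idP/idP => [/(lo_mull x^-1)|/(lo_mull x)]; first by rewrite mulVg.
  by rewrite mulg1 mulVKg.
have {eqLM eqLM1} : lo_lt L = lo_lt M.
  apply/funext => x; apply/funext => y; rewrite !(ltE _ x y).
  have [->|] := eqVneq (x^-1 * y) 1; first by rewrite !lo_irr.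
  exact: eqLM1.
case: L M => [l ? ? ? ?] [m ? ? ? ?] /= eqlm; subst m.
by congr LeftOrdering; exact: Prop_irrelevance.
Qed.

(* LO(G): as cone_point is injective, this initial topology is the subspace
   topology inherited from 2^(G - {1}). *)
HB.instance Definition _ (G : groupType) :=
  Topological.copy (left_ordering G) (initial_topology (@cone_point G)).

Section ConjugateOrdering.
Variables (G : groupType) (L : left_ordering G) (g : G).

Definition conj_lt : rel G := fun x y => L (x * g) (y * g).

Fact conj_irr : irreflexive conj_lt.
Proof. by move=> x; exact: lo_irr. Qed.

Fact conj_trans : transitive conj_lt.
Proof. by move=> y x z; exact: lo_trans. Qed.

Fact conj_total x y : x != y -> conj_lt x y || conj_lt y x.
Proof. by move=> xy; apply: lo_total; rewrite (inj_eq (mulIg g)). Qed.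

Fact conj_mull h x y : conj_lt x y -> conj_lt (h * x) (h * y).
Proof. by move=> xy; rewrite /conj_lt -!mulgA; exact: lo_mull. Qed.

Definition conj_ordering : left_ordering G :=
  LeftOrdering conj_irr conj_trans conj_total conj_mull.

End ConjugateOrdering.

Definition semigroup_gen (G : groupType) (A : set G) : set G :=
  [set g | exists w : seq G,
    [/\ w <> [::], forall x, x \in w -> A x & g = \prod_(x <- w) x]].

Definition fg_semigroup (G : groupType) (M : set G) : Prop :=
  exists A : set G, finite_set A /\ M = semigroup_gen A.

(* The letter (i, false) stands for s_i and (i, true) for s_i^-1. *)
Definition letter n := ('I_n * bool)%type.

Definition word_val (G : groupType) n (s : 'I_n -> G) (w : seq (letter n)) : G :=
  \prod_(l <- w) (if l.2 then (s l.1)^-1 else s l.1).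

Definition generates (G : groupType) n (s : 'I_n -> G) : Prop :=
  forall g : G, exists w : seq (letter n), word_val s w = g.

Definition i_positive n (i : 'I_n) (w : seq (letter n)) : Prop :=
  (i, false) \in w /\
  forall l, l \in w -> (i <= l.1)%N /\ l <> (i, true).

Definition sigma_positive (G : groupType) n (s : 'I_n -> G) : set G :=
  [set g | exists i w, i_positive i w /\ word_val s w = g].

Definition defines_dehornoy_like (G : groupType) n (s : 'I_n -> G)
    (D : left_ordering G) : Prop :=
  positive_cone D = sigma_positive s.

(* Indices start at 0, so the exponent (-1)^(n - i + 1) of the 1-based
   convention becomes (-1)^(n - i). *)
Definition twisted (G : groupType) n (s : 'I_n -> G) (i : 'I_n) : G :=
  let p := \prod_(j < n | (i <= j)%N) s j in
  if odd (n - i)%N then p^-1 else p.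

Definition tail_semigroup (G : groupType) n (a : 'I_n -> G) (i : 'I_n) : set G :=
  semigroup_gen [set a j | j in [set j : 'I_n | (i <= j)%N]].

Definition property_F (G : groupType) n (s : 'I_n -> G) : Prop :=
  let a := twisted s in
  let P := tail_semigroup a in
  forall i i1 : 'I_n, nat_of_ord i1 = i.+1 ->
    [set a i * p^-1 * (a i)^-1 | p in P i1] `<=` P i /\
    [set (a i)^-1 * p^-1 * a i | p in P i1] `<=` P i.

(* Main.v *)
Require Import Defs.
From mathcomp Require Import all_boot all_order all_algebra all_fingroup.
From mathcomp Require Import all_classical all_reals all_analysis.

(** Write a = s_(n-1) and b = s_n, so that the last two twisted generators are
    a b and b^-1.

    The point is that a^-1 b a is represented by a word containing a but not
    a^-1, in the letters a and b^(+-1) only ([ipos_conj_gen]).  Property F makes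
    the conjugates of b by x = a b and by x^-1 products of x and b^-1.  Such a
    product is either (n-1)-positive or a negative power of b.  If x^-1 b x is
    b^-(m+1), then b^-1 is the (m+1)-th power of x b x^-1; this forces x b x^-1
    to be a negative power of b as well, since b^-1 is negative, and the two
    exponents to be -1, since b has infinite order.  Then x b x^-1 = b^-1, which
    is the identity a_n a_(n-1) a_n = a_(n-1) excluded by hypothesis.

    Let h_k = b^-k a.  Then h_k^-1 b h_k = a^-1 b a lies above every power of b,
    whereas b is the least positive element; hence every conjugate ordering
    <_D . h_k differs from <_D ([conj_ordering_fix_least], [gen_last_least]).

    Nevertheless each positive g is eventually positive for <_D . h_k, that is
    g h_k > h_k ([conj_eventually_pos]).  This is automatic when g is i-positive
    with i < n-1, and for the powers of b it is the positivity of a^-1 b a.  If g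
    is (n-1)-positive, let b^p be the part of a representing word that precedes
    its first a; since b^-1 moves the coset a <b> down, h_k < g as soon as
    k > -p ([lt_ipos]), and then g h_k > g > h_k.  So <_D . h_k converges to
    <_D, and <_D is a limit point of its conjugates.

    A finite set of positive elements stays positive for <_D . h_k when k is
    large.  If it generated the positive cone of <_D, then <_D . h_k would be
    equal to <_D, a contradiction. *)

Set Implicit Arguments.
Unset Strict Implicit.
Unset Printing Implicit Defensive.

Local Open Scope classical_set_scope.
Local Open Scope group_scope.

(** * Powers of conjugates and the last two indices *)

Lemma conjugate_expg (G : groupType) (x y : G) m :
  (y^-1 * x * y) ^+ m = y^-1 * x ^+ m * y.
Proof. by rewrite -!mulgA -!conjgE conjXg. Qed.

Lemma ord_last_eq n (j l : 'I_n) : j.+1 = n -> (j <= l)%N -> l = j.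
Proof.
move=> jn jl; apply/val_inj/eqP; rewrite eqn_leq jl andbT.
by have := ltn_ord l; rewrite -{2}jn ltnS.
Qed.

Lemma ord_penultimate_succ n (i j : 'I_n) : i.+2 = n -> j.+1 = n -> i.+1 = j.
Proof. by move=> inn jn; apply: succn_inj; rewrite inn jn. Qed.

(** * Left orderings *)

Lemma lo_ltE (G : groupType) (D : left_ordering G) x y : D x y = D 1 (x^-1 * y).
Proof.
apply/idP/idP => [/(lo_mull x^-1)|/(lo_mull x)]; first by rewrite mulVg.
by rewrite mulg1 mulVKg.
Qed.

Lemma lo_gt1V (G : groupType) (D : left_ordering G) x : D 1 x^-1 = D x 1.
Proof. by rewrite (lo_ltE D x) mulg1. Qed.

Lemma lo_asym (G : groupType) (D : left_ordering G) x y : D x y -> D y x = false.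
Proof.
by move=> xy; apply/negP => /(lo_trans xy); rewrite lo_irr.
Qed.

Lemma lo_gt1M (G : groupType) (D : left_ordering G) x y :
  D 1 x -> D 1 y -> D 1 (x * y).
Proof.
by move=> x1 /(lo_mull x); rewrite mulg1; apply: lo_trans.
Qed.

Lemma lo_gt1X (G : groupType) (D : left_ordering G) x m :
  D 1 x -> D 1 (x ^+ m.+1).
Proof.
move=> x1; elim: m => [|m IHm]; first by rewrite expg1.
by rewrite expgS; apply: lo_gt1M.
Qed.

Lemma lo_gt1_expg_fix (G : groupType) (D : left_ordering G) x m :
  D 1 x -> x ^+ m = x -> m = 1%N.
Proof.
move=> x1; case: m => [xE|[//|m]].
  by move: x1; rewrite -xE expg0 lo_irr.
rewrite expgS -[RHS]mulg1 => /mulgI xE.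
by have := lo_gt1X m x1; rewrite xE lo_irr.
Qed.

(** Positive cones are maximal: G is the disjoint union of P, 1 and P^-1, so
    inclusion of cones forces equality. *)
Lemma left_ordering_eq_of_sub (G : groupType) (D E : left_ordering G) :
  (forall g, D 1 g -> E 1 g) -> E = D.
Proof.
move=> DE; apply: cone_point_inj; apply/funext => -[g g1] /=; rewrite /cone_point /=.
have /orP [Dg|] := lo_total D g1; last by move=> Dg; rewrite Dg DE.
rewrite (lo_asym Dg).
by apply: lo_asym; rewrite -lo_gt1V DE // lo_gt1V.
Qed.

Lemma left_ordering_semigroup_gen_eq (G : groupType) (D E : left_ordering G)
    (A : set G) :
  positive_cone D = semigroup_gen A -> (forall g, A g -> E 1 g) -> E = D.
Proof.
move=> DA AE; apply: left_ordering_eq_of_sub => g Dg.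
have : positive_cone D g by [].
rewrite DA => -[w [w0 wA ->]].
elim: w w0 wA => // x w IHw _ wA; rewrite big_cons.
have x1 : E 1 x by apply/AE/wA; rewrite mem_head.
case: w IHw wA => [|y w] IHw wA; first by rewrite big_nil mulg1.
by apply: lo_gt1M => //; apply: IHw => // z zw; apply: wA; rewrite inE zw orbT.
Qed.

(** The least positive element of the ordering conjugated by h is h b h^-1, so
    an ordering fixed by h has its least positive element commuting with h. *)
Lemma conj_ordering_fix_least (G : groupType) (D : left_ordering G) b h :
  D 1 b -> (forall g, D 1 g -> D g b = false) ->
  conj_ordering D h = D -> h^-1 * b * h = b.
Proof.
move=> b1 bleast hD.
(* Invariance says that conjugation by h preserves positivity. *)
have conj1 x : D 1 x = D 1 (h^-1 * x * h).
  by rewrite -{1}hD /= /conj_lt mul1g lo_ltE mulgA.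
pose d := h * b * h^-1.
have hdh : h^-1 * d * h = b by rewrite /d !mulgA mulVg mul1g mulgVK.
have d1 : D 1 d by rewrite conj1 hdh.
apply/eqP/contraT => /(lo_total D) /orP[|bc].
  by rewrite bleast // -conj1.
have := bleast d d1; rewrite lo_ltE conj1.
have -> : h^-1 * (d^-1 * b) * h = b^-1 * (h^-1 * b * h).
  by rewrite -{2}hdh !invMg invgK !mulgA mulgK.
by rewrite -lo_ltE bc.
Qed.

(** In LO(G) convergence is coordinatewise; a negative g is handled through
    the positive element g^-1. *)
Lemma cvg_left_ordering (G : groupType) (D : left_ordering G)
    (u : nat -> left_ordering G) :
  (forall g, D 1 g -> \forall k \near \oo, u k 1 g) -> u @ \oo --> D.
Proof.
move=> uD.
have cvg_cone : (cone_point (u k)) @[k --> \oo] -->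
    (cone_point D : {ptws {g : G | g != 1} -> bool}).
  (* The product topology is the supremum of those pulled back by evaluations. *)
  apply/cvg_sup => -[g g1]; apply/cvg_image.
    by rewrite eqEsubset; split=> // b _; exists (cst b).
  move=> A /principal_filterP; rewrite {1}/cone_point /= => AD.
  have evg : \forall k \near \oo, u k 1 g = D 1 g.
    have [Dg|Dg] := boolP (D 1 g).
      by apply: (filterS _ (uD g Dg)) => k ->.
    have Dgi : D 1 g^-1.
      by have := lo_total D g1; rewrite lo_gt1V (negPf Dg) orbF.
    by apply: (filterS _ (uD _ Dgi)) => k; rewrite lo_gt1V => /lo_asym ->.
  exists [set f : {ptws {g : G | g != 1} -> bool} | A (f (exist _ g g1))].
    by apply: (filterS _ evg) => k /= ukg; rewrite /cone_point /= ukg.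
  rewrite eqEsubset; split=> [b [f Af <-] //|b Ab].
  by exists (cst b).
move=> U; rewrite nbhsE => -[V [[B Bop BV] VD] VU].
have : nbhs (cone_point D : {ptws {g : G | g != 1} -> bool}) B.
  by apply: open_nbhs_nbhs; split => //; move: VD; rewrite -BV.
by move=> /cvg_cone; apply: (@filterS _ eventually) => k Bk; apply: VU; rewrite -BV.
Qed.

(** * Elements represented by i-positive words *)

Definition ipos_elt (G : groupType) n (s : 'I_n -> G) (i : 'I_n) : set G :=
  [set g | exists w, i_positive i w /\ word_val s w = g].

(** The subgroup generated by the s_k with k > i.  It acts on both sides of the
    i-positive elements, which makes them infinitely large compared with it. *)
Definition later_elt (G : groupType) n (s : 'I_n -> G) (i : 'I_n) : set G :=
  [set g | exists w : seq (letter n),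
    (forall l, l \in w -> (i < l.1)%N) /\ word_val s w = g].

Lemma word_val_cat (G : groupType) n (s : 'I_n -> G) (v w : seq (letter n)) :
  word_val s (v ++ w) = word_val s v * word_val s w.
Proof. by rewrite /word_val big_cat. Qed.

Lemma word_val_cons (G : groupType) n (s : 'I_n -> G) (l : letter n) w :
  word_val s (l :: w) = (if l.2 then (s l.1)^-1 else s l.1) * word_val s w.
Proof. by rewrite /word_val big_cons. Qed.

Lemma later1 (G : groupType) n (s : 'I_n -> G) i : later_elt s i 1.
Proof. by exists [::]; split=> //; rewrite /word_val big_nil. Qed.

Lemma laterM (G : groupType) n (s : 'I_n -> G) i g h :
  later_elt s i g -> later_elt s i h -> later_elt s i (g * h).
Proof.
move=> [v [vi <-]] [w [wi <-]]; exists (v ++ w); split; last exact: word_val_cat.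
by move=> l; rewrite mem_cat => /orP[/vi|/wi].
Qed.

Lemma later_letter (G : groupType) n (s : 'I_n -> G) (i k : 'I_n) (e : bool) :
  (i < k)%N -> later_elt s i (if e then (s k)^-1 else s k).
Proof.
move=> ik; exists [:: (k, e)]; split; first by move=> l; rewrite inE => /eqP ->.
by rewrite /word_val big_seq1.
Qed.

Lemma laterV (G : groupType) n (s : 'I_n -> G) i g :
  later_elt s i g -> later_elt s i g^-1.
Proof.
move=> [w [wi <-]] {g}; elim: w wi => [|[k e] w IHw] wi.
  by rewrite /word_val big_nil invg1; apply: later1.
rewrite word_val_cons invMg; apply: laterM.
  by apply: IHw => l lw; apply: wi; rewrite inE lw orbT.
have ik : (i < k)%N by apply: (wi (k, e)); rewrite mem_head.
by case: e {wi} => /=; rewrite ?invgK;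
  [apply: (@later_letter _ _ _ _ _ false)|apply: (@later_letter _ _ _ _ _ true)].
Qed.

Lemma laterX (G : groupType) n (s : 'I_n -> G) i g m :
  later_elt s i g -> later_elt s i (g ^+ m).
Proof.
move=> gi; elim: m => [|m IHm]; first by rewrite expg0; apply: later1.
by rewrite expgS; apply: laterM.
Qed.

Lemma ipos_gen (G : groupType) n (s : 'I_n -> G) i : ipos_elt s i (s i).
Proof.
exists [:: (i, false)]; split; last by rewrite /word_val big_seq1.
by split=> [|l]; rewrite inE // => /eqP ->.
Qed.

Lemma ipos_mul_word (G : groupType) n (s : 'I_n -> G) i g (w : seq (letter n)) :
  ipos_elt s i g -> (forall l, l \in w -> (i <= l.1)%N /\ l <> (i, true)) ->
  ipos_elt s i (g * word_val s w).
Proof.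
move=> [v [[iv vi] <-]] wi; exists (v ++ w); split; last exact: word_val_cat.
by split=> [|l]; rewrite mem_cat ?iv // => /orP[/vi|/wi].
Qed.

Lemma iposM (G : groupType) n (s : 'I_n -> G) i g h :
  ipos_elt s i g -> ipos_elt s i h -> ipos_elt s i (g * h).
Proof. by move=> gi [w [[_ wi] <-]]; apply: ipos_mul_word. Qed.

Lemma iposX (G : groupType) n (s : 'I_n -> G) i g m :
  ipos_elt s i g -> ipos_elt s i (g ^+ m.+1).
Proof.
move=> gi; elim: m => [|m IHm]; first by rewrite expg1.
by rewrite expgS; apply: iposM.
Qed.

Lemma later_allowed n (i : 'I_n) (l : letter n) :
  (i < l.1)%N -> (i <= l.1)%N /\ l <> (i, true).
Proof. by move=> il; split=> [|lE]; [apply: ltnW|move: il; rewrite lE ltnn]. Qed.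

Lemma ipos_mulr (G : groupType) n (s : 'I_n -> G) i g h :
  ipos_elt s i g -> later_elt s i h -> ipos_elt s i (g * h).
Proof.
move=> gi [w [wi <-]]; apply: ipos_mul_word => // l /wi; exact: later_allowed.
Qed.

Lemma ipos_mull (G : groupType) n (s : 'I_n -> G) i g h :
  later_elt s i h -> ipos_elt s i g -> ipos_elt s i (h * g).
Proof.
move=> [v [vi <-]] [w [[iw wi] <-]].
exists (v ++ w); split; last exact: word_val_cat.
split=> [|l]; rewrite mem_cat ?iw ?orbT // => /orP[/vi|/wi //].
exact: later_allowed.
Qed.

Lemma ipos_gt1 (G : groupType) n (s : 'I_n -> G) (D : left_ordering G) i g :
  defines_dehornoy_like s D -> ipos_elt s i g -> D 1 g.
Proof.
move=> DS [w [iw <-]]; suff : positive_cone D (word_val s w) by [].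
by rewrite DS; exists i, w.
Qed.

Lemma gt1_ipos (G : groupType) n (s : 'I_n -> G) (D : left_ordering G) g :
  defines_dehornoy_like s D -> D 1 g -> exists i, ipos_elt s i g.
Proof.
move=> DS g1; have : positive_cone D g by [].
by rewrite DS => -[i [w iw]]; exists i, w.
Qed.

(** * The conjugates by s_n^-k s_(n-1) *)

Lemma ipos_last (G : groupType) n (s : 'I_n -> G) (j : 'I_n) g :
  j.+1 = n -> ipos_elt s j g -> exists m, g = s j ^+ m.+1.
Proof.
move=> jn [w [[jw wj] <-]].
have -> : word_val s w = s j ^+ size w.
  elim: w wj {jw} => [|[k e] w IHw] wj; first by rewrite /word_val big_nil.
  have [/= jk ke] := wj (k, e) (mem_head _ _).
  have kj := ord_last_eq jn jk.
  rewrite word_val_cons IHw; last by move=> l lw; apply: wj; rewrite inE lw orbT.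
  by move: ke; rewrite kj; case: e {wj} => //= _; rewrite expgS.
by case: w jw {wj} => // l w _; exists (size w).
Qed.

(** Induction on the word representing g: while its first letter is b^(+-1),
    removing that letter shifts k by one; when it is a, what has to be positive
    is (a^-1 b^k a) q, where q contains no a^-1 and a^-1 b^k a is
    (n-1)-positive. *)
Lemma lt_ipos (G : groupType) n (s : 'I_n -> G) (D : left_ordering G)
    (i j : 'I_n) g :
  defines_dehornoy_like s D -> i.+2 = n -> j.+1 = n ->
  ipos_elt s i ((s i)^-1 * s j * s i) -> ipos_elt s i g ->
  exists K, forall k, (K <= k)%N -> D (s j ^- k * s i) g.
Proof.
move=> DS inn jn iab [w [+ <-]] {g}.
elim: w => [[]//|[l e] w IHw] [iw wi].
have wi' l' : l' \in w -> (i <= l'.1)%N /\ l' <> (i, true).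
  by move=> lw; apply: wi; rewrite inE lw orbT.
have [/= il le] := wi _ (mem_head _ _).
rewrite word_val_cons /=; have [li|ni] := eqVneq l i.
  (* k = 0 is not enough here, since what follows a may be negative. *)
  have -> /= : e = false by move: le; rewrite li; case: (e).
  exists 1%N => -[//|k] _; rewrite lo_ltE invMg invgK -li.
  rewrite !mulgA; apply: (ipos_gt1 (i := i) DS).
  apply: ipos_mul_word => //; rewrite li.
  by rewrite -conjugate_expg; apply: iposX.
have lj : l = j.
  apply: (ord_last_eq jn); rewrite -(ord_penultimate_succ inn jn).
  by rewrite ltn_neqAle il andbT eq_sym.
have [|K KP] := IHw.
  split=> //; move: iw; rewrite inE => /orP[/eqP [il' _]|//].
  by rewrite il' eqxx in ni.
exists K.+1 => -[//|k]; rewrite ltnS lj => Kk.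
(* Left multiplication by b^-1 or by b turns the bound for the shorter word at
   k - 1, respectively k + 1, into the bound at k. *)
case: e {wi le iw} => /=.
  have := lo_mull (s j)^-1 (KP k Kk).
  by rewrite mulgA -invMg -expgSr.
have := lo_mull (s j) (KP _ (leqW (leqW Kk))).
by rewrite (expgSr _ k.+1) invMg !mulgA mulgV mul1g.
Qed.

(** With h = b^-k a, the claim is that h^-1 g h is positive.  Conjugation by h
    preserves l-positivity for l < n-1, it sends b^m to (a^-1 b a)^m, and for an
    (n-1)-positive g the inequality h < g implies h < g < g h as h is positive. *)
Lemma conj_eventually_pos (G : groupType) n (s : 'I_n -> G)
    (D : left_ordering G) (i j : 'I_n) g :
  defines_dehornoy_like s D -> i.+2 = n -> j.+1 = n ->
  ipos_elt s i ((s i)^-1 * s j * s i) -> D 1 g ->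
  exists K, forall k, (K <= k)%N ->
    conj_ordering D (s j ^- k * s i) 1 g.
Proof.
move=> DS inn jn iab g1; have [l lg] := gt1_ipos DS g1.
have ij : (i < j)%N by rewrite -(ord_penultimate_succ inn jn).
have lati (l' : 'I_n) : (l' < i)%N -> later_elt s l' (s i).
  exact: (@later_letter _ _ _ _ _ false).
have latj (l' : 'I_n) k : (l' < j)%N -> later_elt s l' (s j ^- k).
  by move=> lj; apply/laterV/laterX/(@later_letter _ _ _ _ _ false).
have conjE h x : conj_ordering D h 1 x = D h (x * h).
  by rewrite /= /conj_lt mul1g.
have [li|il|eqli] := ltngtP l i.
- exists 0 => k _; rewrite conjE lo_ltE; apply: (ipos_gt1 (i := l) DS).
  have lh : later_elt s l (s j ^- k * s i).
    by apply: laterM; [apply/latj/(ltn_trans li)|apply: lati].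
  by apply: ipos_mull; [apply: laterV|apply: ipos_mulr].
- have lj : l = j.
    by apply: (ord_last_eq jn); rewrite -(ord_penultimate_succ inn jn).
  rewrite lj in lg; have [m ->] := ipos_last jn lg.
  exists 0 => k _; rewrite conjE lo_ltE; apply: (ipos_gt1 (i := i) DS).
  have -> : (s j ^- k * s i)^-1 * (s j ^+ m.+1 * (s j ^- k * s i))
            = ((s i)^-1 * s j * s i) ^+ m.+1.
    rewrite conjugate_expg invMg invgK !mulgA; congr (_ * _).
    by rewrite -!mulgA; congr (_ * _); rewrite mulgA -expgnDr addnC expgnDr mulgK.
  exact: iposX.
- have {}eqli : l = i by apply: val_inj.
  rewrite eqli in lg; have [K KP] := lt_ipos DS inn jn iab lg.
  exists K => k /KP hg; rewrite conjE; apply: (lo_trans hg).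
  rewrite lo_ltE mulKg; apply: (ipos_gt1 (i := i) DS).
  by apply: ipos_mull; [apply: latj|apply: ipos_gen].
Qed.

(** If g is i-positive with i smaller than the last index, then so is
    s_n^-1 g; otherwise g is a positive power of s_n. *)
Lemma gen_last_least (G : groupType) n (s : 'I_n -> G) (D : left_ordering G)
    (j : 'I_n) g :
  defines_dehornoy_like s D -> j.+1 = n -> D 1 g -> D g (s j) = false.
Proof.
move=> DS jn g1; have [l lg] := gt1_ipos DS g1.
have [jl|lj] := leqP j l.
  have lE := ord_last_eq jn jl.
  rewrite lE in lg; have [[|m] ->] := ipos_last jn lg.
    by rewrite expg1 lo_irr.
  apply: lo_asym; rewrite lo_ltE expgS mulKg; apply: lo_gt1X.
  by apply/(ipos_gt1 DS)/ipos_gen.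
apply: lo_asym; rewrite lo_ltE; apply/(ipos_gt1 DS)/ipos_mull/lg.
exact/laterV/(@later_letter _ _ _ _ _ false).
Qed.

(** * The consequence of Property F *)

Lemma twisted_last (G : groupType) n (s : 'I_n -> G) (j : 'I_n) :
  j.+1 = n -> twisted s j = (s j)^-1.
Proof.
move=> jn; rewrite /twisted (_ : n - j = 1)%N; last by rewrite -{1}jn subSnn.
rewrite (big_pred1 j) // => k; apply/idP/eqP => [jk|-> //].
exact: (ord_last_eq jn).
Qed.

Lemma twisted_penultimate (G : groupType) n (s : 'I_n -> G) (i j : 'I_n) :
  i.+2 = n -> j.+1 = n -> twisted s i = s i * s j.
Proof.
move=> inn jn; rewrite /twisted (_ : n - i = 2)%N; last first.
  by rewrite -{1}inn subSn // subSnn.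
case: n s i j inn jn => [|[|m]] s i j; [by case: i|by case: i => [[]]|].
move=> [im] [jm]; rewrite /= !big_mkcond !big_ord_recr /= big1.
  rewrite im leqnn leqnSn /= mul1g; congr (s _ * s _); exact: val_inj.
by move=> [k km] _; rewrite im /= leqNgt km.
Qed.

(** A nonempty product of a b and b^-1 contains a, and then never a^-1, or it is
    a negative power of b. *)
Lemma tail_semigroup_penultimate (G : groupType) n (s : 'I_n -> G)
    (i j : 'I_n) g :
  i.+2 = n -> j.+1 = n -> tail_semigroup (twisted s) i g ->
  ipos_elt s i g \/ exists m, g = s j ^- m.+1.
Proof.
move=> inn jn [w [w0 wP ->]] {g}.
have ij : (i < j)%N by rewrite -(ord_penultimate_succ inn jn).
have latj m : later_elt s i (s j ^- m).
  exact/laterV/laterX/(@later_letter _ _ _ _ _ false).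
have letterP x : x \in w -> ipos_elt s i x \/ x = (s j)^-1.
  move=> /wP [k /= ik <-]; have [->|kj] := eqVneq k j.
    by right; apply: twisted_last.
  left; have -> : k = i.
    apply/val_inj/eqP; rewrite eqn_leq ik andbT leqNgt; apply: contra kj.
    by rewrite (ord_penultimate_succ inn jn) => /(ord_last_eq jn) ->.
  rewrite (twisted_penultimate s inn jn); apply: ipos_mulr (ipos_gen _ _) _.
  exact: (@later_letter _ _ _ _ _ false).
have : ipos_elt s i (\prod_(x <- w) x) \/ \prod_(x <- w) x = s j ^- size w.
  elim: w letterP {w0 wP} => [|x w IHw] letterP.
    by right; rewrite big_nil expg0 invg1.
  have [|wi|wj] := IHw; first by move=> y yw; apply: letterP; rewrite inE yw orbT.
    left; rewrite big_cons; case: (letterP x (mem_head _ _)) => [xi|->].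
      exact: iposM.
    by apply: ipos_mull wi; have := latj 1%N; rewrite expg1.
  rewrite big_cons wj; case: (letterP x (mem_head _ _)) => [xi|->].
    by left; apply: ipos_mulr.
  by right; rewrite /= expgSr invMg.
by case: w w0 {wP letterP} => // x w _ [|->]; [left|right; exists (size w)].
Qed.

(** Both inclusions of Property F at the index n-1 are needed: the second alone
    allows x^-1 b x = b^-(m+1) with x = a b, and the first is then used to show
    that m = 0, which is the excluded relation. *)
Lemma ipos_conj_gen (G : groupType) n (s : 'I_n -> G) (D : left_ordering G)
    (i j : 'I_n) :
  property_F s -> defines_dehornoy_like s D -> i.+2 = n -> j.+1 = n ->
  twisted s j * twisted s i * twisted s j <> twisted s i ->
  ipos_elt s i ((s i)^-1 * s j * s i).
Proof.
move=> FS DS inn jn; rewrite (twisted_last s jn) => nontriv.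
have ij : (i < j)%N by rewrite -(ord_penultimate_succ inn jn).
have latj : later_elt s i (s j) by exact: (@later_letter _ _ _ _ _ false).
have b1 : D 1 (s j) by apply/(ipos_gt1 DS)/ipos_gen.
have jP : tail_semigroup (twisted s) j (s j)^-1.
  exists [:: (s j)^-1]; split=> //; last by rewrite big_seq1.
  by move=> x; rewrite inE => /eqP ->; exists j => //=; apply: twisted_last.
have ji : nat_of_ord j = i.+1 by rewrite (ord_penultimate_succ inn jn).
have [F1 F2] := FS i j ji.
set x := twisted s i in nontriv F1 F2.
have {F1} /(tail_semigroup_penultimate inn jn) W2 :
    tail_semigroup (twisted s) i (x * s j * x^-1).
  by apply: F1; exists (s j)^-1; rewrite // invgK.
have {F2} /(tail_semigroup_penultimate inn jn) W1 :
    tail_semigroup (twisted s) i (x^-1 * s j * x).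
  by apply: F2; exists (s j)^-1; rewrite // invgK.
case: W1 => [W1|[m W1]].
  (* a = x b^-1, so the conjugates by a and by x differ by a conjugation by b. *)
  have -> : (s i)^-1 * s j * s i = s j * (x^-1 * s j * x) * (s j)^-1.
    rewrite /x (twisted_penultimate s inn jn) invMg !mulgA mulgV mul1g.
    by rewrite mulgK.
  by apply: ipos_mulr (laterV latj); apply: ipos_mull.
have bE : (x * s j * x^-1) ^+ m.+1 = (s j)^-1.
  have -> : (x * s j * x^-1) ^+ m.+1 = x * s j ^+ m.+1 * x^-1.
    by have := conjugate_expg (s j) x^-1 m.+1; rewrite invgK.
  by rewrite -[_ ^+ _]invgK -W1 !invMg invgK !mulgA mulgV mul1g mulgK.
case: W2 => [W2|[l W2]].
  have := ipos_gt1 DS (iposX m W2).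
  by rewrite bE lo_gt1V (lo_asym b1).
have := lo_gt1_expg_fix b1 (m := (l.+1 * m.+1)%N).
rewrite expgnA -[X in X = _ -> _]invgK -expVgn -W2 bE invgK => /(_ erefl) /eqP.
rewrite muln_eq1 => /andP[/eqP [l0] _]; case: nontriv.
rewrite l0 expg1 in W2.
by rewrite -{1}W2 mulgVK mulgK.
Qed.

(** * Accumulation of the conjugates *)

Theorem theorem2 (G : groupType) (n : nat) (s : 'I_n -> G)
    (D : left_ordering G) (i j : 'I_n) :
  (1 < n)%N ->
  generates s ->
  property_F s ->
  defines_dehornoy_like s D ->
  i.+2 = n -> j.+1 = n ->
  twisted s j * twisted s i * twisted s j <> twisted s i ->
  [/\ limit_point [set conj_ordering D g | g in [set: G]] D,
      ~ isolated [set: left_ordering G] D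
    & ~ fg_semigroup (sigma_positive s)].
Proof.
move=> _ _ FS DS inn jn nontriv.
have iab := ipos_conj_gen FS DS inn jn nontriv.
have ij : (i < j)%N by rewrite -(ord_penultimate_succ inn jn).
have latj : later_elt s i (s j) by exact: (@later_letter _ _ _ _ _ false).
pose u k := conj_ordering D (s j ^- k * s i).
have evpos g : D 1 g -> \forall k \near \oo, u k 1 g.
  move=> /(conj_eventually_pos DS inn jn iab) [K KP].
  by exists K => // k /= /KP.
have uneq k : u k <> D.
  (* If u k = D, then b commutes with b^-k a, hence a^-1 b a = b. *)
  have b1 : D 1 (s j) by apply/(ipos_gt1 DS)/ipos_gen.
  move=> /(conj_ordering_fix_least b1 (fun g => gen_last_least (g := g) DS jn)) bfix.
  have : D 1 ((s j)^-1 * ((s i)^-1 * s j * s i)).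
    by apply/(ipos_gt1 DS)/ipos_mull/iab/laterV.
  suff -> : (s i)^-1 * s j * s i = s j by rewrite mulVg lo_irr.
  rewrite -[RHS]bfix invMg invgK !mulgA; congr (_ * _).
  by rewrite -!mulgA; congr (_ * _); rewrite mulgA -expgSr expgS mulgK.
have lim : limit_point [set conj_ordering D g | g in [set: G]] D.
  move=> U /(cvg_left_ordering evpos) [K _ KU]; exists (u K); split.
  - exact/eqP/uneq.
  - by exists (s j ^- K * s i).
  - exact: (KU K (leqnn _)).
split=> //.
  have /disj_setPS /(_ D) disjD :=
    disjoint_isolated_limit_point [set: left_ordering G].
  by move=> iso; apply: disjD; split=> // U /lim [y [? _ ?]]; exists y.
move=> [A [finA SA]].
have [K KA] : exists K, forall g, A g -> u K 1 g.
  have Apos g : A g -> \forall k \near \oo, u k 1 g.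
    move=> Ag; apply: evpos; suff : positive_cone D g by [].
    rewrite DS SA; exists [:: g]; split=> //; last by rewrite big_seq1.
    by move=> x; rewrite inE => /eqP ->.
  have [K _ KP] : \forall k \near \oo, forall g, A g -> u k 1 g.
    have [X AX] := finite_fsetP.1 finA.
    have evX := @filter_bigI _ _ X (fun g => [set k | u k 1 g]) _ eventually_filter.
    apply: (filterS _ (evX _)) => [k kX g|g gX]; first by rewrite AX => /kX.
    by apply: Apos; rewrite AX.
  by exists K; apply: KP => /=.
by apply: (uneq K); apply: (left_ordering_semigroup_gen_eq _ KA); rewrite -SA.
Qed.
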